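(* Let $b>0$ and $\lambda\in(0,1)$. Then for all CAT(0) spaces $X$, all bounded subsets $C\subseteq X$ with diameter $d_C\le b$, all $\lambda$-firmly nonexpansive mappings $T:C\to C$ and all $x\in C$, the following holds: $$\forall\varepsilon>0\ \forall n\ge\Psi(\varepsilon,\lambda,b)\quad d(T^nx,T^{n+1}x)\le\varepsilon,$$ where $n$ ranges over the natural numbers and $$\Psi(\varepsilon,\lambda,b):=\begin{cases}\left[\dfrac{8(b+1)^2}{\lambda(1-\lambda)}\cdot\dfrac1{\varepsilon^2}\right]&\text{for }\varepsilon<2b,\\[2mm]0&\text{otherwise},\end{cases}$$ with $[\cdot]$ denoting the integer part.
   Context: A geodesic in a metric space $(X,d)$ is a map $\gamma:[a,b]\to X$ with $d(\gamma(s),\gamma(t))=|s-t|$ for all $s,t\in[a,b]$; $X$ is a geodesic space if any two distinct points are the endpoints $\gamma(a),\gamma(b)$ of some geodesic. A CAT(0) space is a geodesic space such that for all $x,y,z\in X$ and all $m\in X$ with $d(x,m)=d(y,m)=\frac12d(x,y)$ one has $d(z,m)^2\le\frac12d(z,x)^2+\frac12d(z,y)^2-\frac14d(x,y)^2$. In a CAT(0) space, for $x,y\in X$ and $\lambda\in[0,1]$, $(1-\lambda)x\oplus\lambda y$ denotes the unique point $z$ with $d(x,z)=\lambda d(x,y)$ and $d(y,z)=(1-\lambda)d(x,y)$. For $C\subseteq X$ and $\lambda\in(0,1)$, a map $T:C\to X$ is $\lambda$-firmly nonexpansive if $d(Tx,Ty)\le d((1-\lambda)x\oplus\lambda Tx,(1-\lambda)y\oplus\lambda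 Ty)$ for all $x,y\in C$. *)

(* Defs.v *)
From HB Require Import structures.
From mathcomp Require Import all_boot all_order all_algebra.
From mathcomp Require Import ring lra.
From mathcomp Require Import mathcomp_extra boolp classical_sets functions.
From mathcomp Require Import set_interval reals topology.

Set Implicit Arguments.
Unset Strict Implicit.
Unset Printing Implicit Defensive.

Import Order.TTheory GRing.Theory Num.Theory.

Local Open Scope classical_set_scope.
Local Open Scope ring_scope.

(* Maps whose domain is a part D of a type are total functions, constrained
   only on D. *)

(* A geodesic defined on the interval `[a, b], which must be nonempty. *)
Definition is_geodesic (R : realType) (X : metricType R) (a b : R)
    (g : R -> X) : Prop :=
  a <= b /\
  forall s t, s \in `[a, b] -> t \in `[a, b] -> mdist (g s) (g t) = `|s - t|.

Definition geodesic_space (R : realType) (X : metricType R) : Prop :=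
  forall x y : X, x <> y ->
    exists a b (g : R -> X), [/\ is_geodesic a b g, g a = x & g b = y].

Definition CAT0 (R : realType) (X : metricType R) : Prop :=
  geodesic_space X /\
  forall x y z m : X,
    mdist x m = 2^-1 * mdist x y -> mdist y m = 2^-1 * mdist x y ->
    mdist z m ^+ 2 <=
      2^-1 * mdist z x ^+ 2 + 2^-1 * mdist z y ^+ 2 - 4^-1 * mdist x y ^+ 2.

Definition is_conv_comb (R : realType) (X : metricType R) (l : R) (x y : X)
    : set X :=
  [set z | mdist x z = l * mdist x y /\ mdist y z = (1 - l) * mdist x y].

(* (1 - l) x (+) l y; the default value x of xget is irrelevant in a CAT(0)
   space with 0 <= l <= 1, see conv_combP and conv_comb_unique below. *)
Definition conv_comb (R : realType) (X : metricType R) (l : R) (x y : X) : X :=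
  xget x (is_conv_comb l x y).

Definition firmly_nonexpansive (R : realType) (X : metricType R) (l : R)
    (C : set X) (T : X -> X) : Prop :=
  forall x y, C x -> C y ->
    mdist (T x) (T y) <= mdist (conv_comb l x (T x)) (conv_comb l y (T y)).

Definition distances (R : realType) (X : metricType R) (C : set X) : set R :=
  [set mdist x y | x in C & y in C].

Definition bounded_subset (R : realType) (X : metricType R) (C : set X)
    : Prop := has_ubound (distances C).

(* Meaningful for bounded C only: sup is 0 on sets without upper bound. *)
Definition diameter (R : realType) (X : metricType R) (C : set X) : R :=
  sup (distances C).

Definition Psi (R : realType) (eps l b : R) : nat :=
  if eps < 2 * b
  then Num.truncn (8 * (b + 1) ^+ 2 / (l * (1 - l)) * (1 / eps ^+ 2))
  else 0%N.

Lemma conv_comb_exists (R : realType) (X : metricType R) (l : R) (x y : X) :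
  geodesic_space X -> 0 <= l <= 1 -> exists z, is_conv_comb l x y z.
Proof.
move=> geoX /andP[l0 l1]; have [<-|xy] := pselect (x = y).
  by exists x; rewrite /is_conv_comb /= !mdistxx !mulr0.
have [a [b [g [[ab gE] <- <-]]]] := geoX _ _ xy.
have aI : a \in `[a, b] by rewrite in_itv /= lexx.
have bI : b \in `[a, b] by rewrite in_itv /= lexx andbT.
have cI : a + l * (b - a) \in `[a, b] by rewrite in_itv /=; nra.
exists (g (a + l * (b - a))); rewrite /is_conv_comb /= !gE//.
have caE : a + l * (b - a) - a = l * (b - a) by ring.
have bcE : b - (a + l * (b - a)) = (1 - l) * (b - a) by ring.
rewrite !(distrC a) caE bcE !normrM (ger0_norm l0).
by rewrite (ger0_norm (x := 1 - l)) ?subr_ge0.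
Qed.

Lemma conv_comb_unique (R : realType) (X : metricType R) (l : R) (x y : X) :
  CAT0 X -> 0 <= l <= 1 -> is_subset1 (is_conv_comb l x y).
Proof.
move=> [geoX cat] /andP[l0 l1] z w [xz yz] [xw yw].
have half01 : 0 <= (2^-1 : R) <= 1 by lra.
have [m [zm wm]] := conv_comb_exists z w geoX half01.
have wm' : mdist w m = 2^-1 * mdist z w by rewrite wm; lra.
have := cat _ _ x _ zm wm'; have := cat _ _ y _ zm wm'; rewrite xz yz xw yw.
have := metric_triangle x m y; rewrite (metric_sym m y).
have := mdist_ge0 x m; have := mdist_ge0 y m; have := mdist_ge0 x y.
have zw0 := mdist_ge0 z w.
move: (mdist x m) (mdist y m) (mdist x y) => p q D D0 q0 p0 Dpq hq hp.
apply: mdist_positivity; apply/eqP; rewrite eq_le zw0 andbT leNgt.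
apply/negP => zwp.
have zw2 : 0 < mdist z w ^+ 2 by rewrite exprn_gt0.
have pl : p < l * D by rewrite -(ltr_pXn2r (n := 2)) ?nnegrE ?mulr_ge0//; lra.
have ql : q < (1 - l) * D.
  by rewrite -(ltr_pXn2r (n := 2)) ?nnegrE ?mulr_ge0 ?subr_ge0//; lra.
lra.
Qed.

Lemma conv_combP (R : realType) (X : metricType R) (l : R) (x y : X) :
  CAT0 X -> 0 <= l <= 1 -> is_conv_comb l x y (conv_comb l x y).
Proof.
by move=> [geoX _] l01; apply: xgetPex; exact: conv_comb_exists.
Qed.

(* Main.v *)
(* Write a n = d(T^n x, T^(n+1) x), which is nonincreasing.  Without a fixed
   point one first shows a n -> 0: the limits D k of d(T^n x, T^(n+k) x) form a
   midpoint-convex sequence with D 0 = 0 and, C being bounded, D k <= b, so that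
   D 1 = 0.  Hence iterates p with d(p, Tp) arbitrarily small exist, and the
   usual Fejer estimate
     l (1 - l) (a i)^2 <= (1 - l) (d(p, T^i x)^2 - d(p, T^(i+1) x)^2) + error,
   summed over i <= n and followed by error -> 0, gives
   (n + 1) l (1 - l) (a n)^2 <= b^2. *)
Require Import Defs.
From mathcomp Require Import all_boot all_order all_algebra.
From mathcomp Require Import ring lra.
From mathcomp Require Import boolp classical_sets functions reals topology.
From mathcomp Require Import normedtype sequences.
Import Order.TTheory GRing.Theory Num.Theory. 
Import numFieldNormedType.Exports.
Local Open Scope classical_set_scope.
Local Open Scope ring_scope.

(** * Distance estimates for convex combinations in CAT(0) spaces *)

(* Every t is the midpoint of 0 or 1 and another point of [0, 1], so any upper
   bound can be halved; no continuity is needed. *)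
Lemma midpoint_convex_le0 (R : realType) (phi : R -> R) (B : R) :
  (forall s t, 0 <= s <= 1 -> 0 <= t <= 1 ->
    phi (2^-1 * (s + t)) <= 2^-1 * (phi s + phi t)) ->
  (forall t, 0 <= t <= 1 -> phi t <= B) -> phi 0 <= 0 -> phi 1 <= 0 ->
  forall t, 0 <= t <= 1 -> phi t <= 0.
Proof.
move=> mid bnd phi0 phi1 t t01.
have halving k : forall s, 0 <= s <= 1 -> (2 ^+ k) * phi s <= `|B|.
  elim: k => [s s01|k IH s s01].
    by have := bnd s s01; have := ler_norm B; lra.
  have [s_le|s_gt] := leP s (2^-1).
    have s01' : 0 <= 2 * s <= 1 by lra.
    have h0 : 0 <= (0 : R) <= 1 by lra.
    have := mid _ _ h0 s01'; rewrite add0r mulKf ?pnatr_eq0// => h.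
    apply: le_trans (IH _ s01'); rewrite exprSr -mulrA.
    by apply: ler_wpM2l; [exact: exprn_ge0|lra].
  have s01' : 0 <= 2 * s - 1 <= 1 by lra.
  have h1 : 0 <= (1 : R) <= 1 by lra.
  have := mid _ _ h1 s01'; rewrite addrC subrK mulKf ?pnatr_eq0// => h.
  apply: le_trans (IH _ s01'); rewrite exprSr -mulrA.
  by apply: ler_wpM2l; [exact: exprn_ge0|lra].
rewrite leNgt; apply/negP => phi_gt0.
set k := (Num.truncn (`|B| / phi t)).+1.
have : `|B| / phi t < k%:R by exact: truncnS_gt.
have : k%:R <= (2 ^ k)%:R :> R by rewrite ler_nat ltnW// ltn_expl.
move=> /[swap] /lt_le_trans /[apply].
by rewrite ltr_pdivrMr// ltNge natrX halving.
Qed.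

(** Along a geodesic [h] from [x] to [y], the defect [phi] of this inequality is midpoint convex: at
    the midpoint m of s and t, m(1 - m) exceeds the mean of s(1 - s) and t(1 - t) by (s - t)^2 / 4,
    which is exactly the CAT(0) correction term. Since [phi] vanishes at both ends and is bounded
    above, it is nonpositive. *)
Lemma CAT0_conv_comb (R : realType) (X : metricType R) (l : R) (x y u : X) :
  CAT0 X -> 0 <= l <= 1 ->
  mdist u (conv_comb l x y) ^+ 2 <=
    (1 - l) * mdist u x ^+ 2 + l * mdist u y ^+ 2
    - l * (1 - l) * mdist x y ^+ 2.
Proof.
move=> hX l01; have [geoX cat] := hX.
have [<-|xy] := pselect (x = y).
  have [+ _] := conv_combP x x hX l01.
  by rewrite mdistxx mulr0 => /mdist_positivity <-; lra.
have [a [b [g [[ab gE] ga gb]]]] := geoX _ _ xy.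
set h := fun t => g (a + t * (b - a)).
have hE s t : 0 <= s <= 1 -> 0 <= t <= 1 ->
    mdist (h s) (h t) = `|s - t| * (b - a).
  move=> s01 t01; rewrite /h gE ?in_itv /=; [|nra|nra].
  have -> : a + s * (b - a) - (a + t * (b - a)) = (s - t) * (b - a) by ring.
  by rewrite normrM (ger0_norm (x := b - a)) ?subr_ge0.
have h0 : h 0 = x by rewrite /h mul0r addr0.
have h1 : h 1 = y by rewrite /h mul1r addrC subrK.
have i0 : 0 <= (0 : R) <= 1 by lra.
have i1 : 0 <= (1 : R) <= 1 by lra.
have xyE : mdist x y = b - a by rewrite -h0 -h1 hE// sub0r normrN1 mul1r.
have -> : conv_comb l x y = h l.
  apply: (conv_comb_unique hX l01 (conv_combP x y hX l01)).
  split; rewrite -?h0 -?h1 !hE// ?sub0r ?normrN1 ?normrN ?mul1r.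
    by rewrite ger0_norm//; case/andP: l01.
  by rewrite ger0_norm ?subr_ge0//; case/andP: l01.
set phi := fun t => mdist u (h t) ^+ 2 - (1 - t) * mdist u x ^+ 2
  - t * mdist u y ^+ 2 + t * (1 - t) * mdist x y ^+ 2.
suff : phi l <= 0 by rewrite /phi; lra.
have ux0 := mdist_ge0 u x.
have uy0 := mdist_ge0 u y.
have D0 := mdist_ge0 x y.
(* The bound comes from d(u, h t) <= d(u, x) + d(x, y) and t(1 - t) <= 1, the other two terms of
   [phi] being nonpositive. *)
apply: (@midpoint_convex_le0 _ _
  ((mdist u x + mdist x y) ^+ 2 + mdist x y ^+ 2)); last exact: l01.
- move=> s t s01 t01.
  have m01 : 0 <= 2^-1 * (s + t) <= 1 by lra.
  have sm : mdist (h s) (h (2^-1 * (s + t))) = 2^-1 * mdist (h s) (h t).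
    rewrite !hE// mulrA; congr (_ * _).
    rewrite -{2}(ger0_norm (x := 2^-1 : R)) ?invr_ge0// -normrM.
    by congr (`|_|); lra.
  have tm : mdist (h t) (h (2^-1 * (s + t))) = 2^-1 * mdist (h s) (h t).
    rewrite !hE// mulrA; congr (_ * _).
    rewrite -{2}(ger0_norm (x := 2^-1 : R)) ?invr_ge0// -normrM distrC.
    by congr (`|_|); lra.
  have := cat _ _ u _ sm tm; rewrite hE// exprMn real_normK ?num_real// -xyE.
  by rewrite /phi; lra.
- move=> t t01; rewrite /phi.
  have : mdist u (h t) <= mdist u x + mdist x y.
    apply: le_trans (metric_triangle u x (h t)) _; rewrite lerD2l.
    rewrite -{1}h0 hE// -xyE sub0r normrN ger0_norm; last by case/andP: t01.
    by rewrite ler_piMl//; case/andP: t01.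
  have := mdist_ge0 u (h t); case/andP: t01 => t0 t1.
  move: (mdist u (h t)) (mdist u x) (mdist u y) (mdist x y) ux0 uy0 D0.
  move=> p q r D q0 r0 D0 p0 pq.
  have : p ^+ 2 <= (q + D) ^+ 2 by rewrite lerXn2r ?nnegrE ?addr_ge0.
  have : t * (1 - t) * D ^+ 2 <= D ^+ 2.
    by rewrite ler_piMl ?sqr_ge0//; nra.
  have : 0 <= (1 - t) * q ^+ 2 by rewrite mulr_ge0 ?sqr_ge0 ?subr_ge0.
  have : 0 <= t * r ^+ 2 by rewrite mulr_ge0 ?sqr_ge0.
  lra.
- by rewrite /phi h0; lra.
- by rewrite /phi h1; lra.
Qed.

(** With q = d(u, x) and r = d(u, y), the triangle inequality gives (q - r)^2 <= d(x, y)^2, and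
    replacing d(x, y)^2 by (q - r)^2 in [CAT0_conv_comb] leaves a perfect square. *)
Lemma conv_comb_dist_le (R : realType) (X : metricType R) (l : R) (x y u : X) :
  CAT0 X -> 0 <= l <= 1 ->
  mdist u (conv_comb l x y) <= (1 - l) * mdist u x + l * mdist u y.
Proof.
move=> hX l01; have := CAT0_conv_comb _ _ l x y u hX l01.
have := metric_triangle x u y; rewrite (metric_sym x u).
have := metric_triangle u x y.
have := metric_triangle u y x; rewrite (metric_sym y x).
case/andP: l01 => l0 l1.
have := mdist_ge0 x y; have := mdist_ge0 u x; have := mdist_ge0 u y.
have := mdist_ge0 u (conv_comb l x y).
move: (mdist u _) (mdist u x) (mdist u y) (mdist x y).
move=> p q r D p0 r0 q0 D0 t1 t2 t3 pqr.
have l1' : 0 <= 1 - l by rewrite subr_ge0.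
rewrite -(ler_pXn2r (n := 2)) ?nnegrE ?addr_ge0 ?mulr_ge0//.
apply: le_trans pqr _.
have qrD : (q - r) ^+ 2 <= D ^+ 2 by nra.
have := ler_wpM2l (mulr_ge0 l0 l1') qrD.
nra.
Qed.

(** [CAT0_conv_comb] is used twice, once for each combination; since the first one lies at distance
    l d(x, y) from [x], everything cancels except l^2 d(y, u)^2. *)
Lemma conv_comb_common_endpoint (R : realType) (X : metricType R) (l : R)
    (x y u : X) :
  CAT0 X -> 0 <= l <= 1 ->
  mdist (conv_comb l x y) (conv_comb l x u) <= l * mdist y u.
Proof.
move=> hX l01; have l0 : 0 <= l by case/andP: l01.
rewrite -(ler_pXn2r (n := 2)) ?nnegrE ?mulr_ge0 ?mdist_ge0//.
apply: le_trans (CAT0_conv_comb _ _ l x u _ hX l01) _.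
have := CAT0_conv_comb _ _ l x y u hX l01.
have [xz _] := conv_combP x y hX l01.
rewrite !(metric_sym (conv_comb l x y)) xz (metric_sym u x) (metric_sym u y).
move=> /(ler_wpM2l l0); nra.
Qed.

Lemma conv_comb_conv_comb_le (R : realType) (X : metricType R) (l : R)
    (x y u v : X) :
  CAT0 X -> 0 <= l <= 1 ->
  mdist (conv_comb l x y) (conv_comb l u v) <=
    (1 - l) * mdist x u + l * mdist y v.
Proof.
move=> hX l01; have l01' : 0 <= 1 - l <= 1 by lra.
(* Reversing the segment puts the shared endpoint [v] first, so the common-endpoint estimate applies
   on both sides of the intermediate point [conv_comb l x v]. *)
have swap (p q : X) : conv_comb l p q = conv_comb (1 - l) q p.
  apply: (@conv_comb_unique _ _ l p q hX l01); first exact: conv_combP.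
  have [] := conv_combP q p hX l01'.
  by rewrite (metric_sym q p) /is_conv_comb /= subKr.
apply: le_trans (metric_triangle _ (conv_comb l x v) _) _.
rewrite addrC lerD ?conv_comb_common_endpoint//.
by rewrite !(swap _ v) conv_comb_common_endpoint.
Qed.

(** * Consequences of firm nonexpansiveness *)

Lemma firmly_nonexpansive_nonexpansive (R : realType) (X : metricType R)
    (l : R) (C : set X) (T : X -> X) (x y : X) :
  CAT0 X -> 0 < l < 1 -> firmly_nonexpansive l C T -> C x -> C y ->
  mdist (T x) (T y) <= mdist x y.
Proof.
move=> hX l01 hT Cx Cy; have l01' : 0 <= l <= 1 by lra.
(* The term l d(Tx, Ty) is absorbed on the left, and 1 - l > 0 is cancelled. *)
have := conv_comb_conv_comb_le _ _ l x (T x) y (T y) hX l01'.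
by have := hT _ _ Cx Cy; case/andP: l01; nra.
Qed.

(** Convexity of the distance is applied in each argument in turn. The cross distances are kept
    because, for two iterates k + 1 steps apart, they join iterates k + 2 and k steps apart. *)
Lemma firmly_nonexpansive_cross (R : realType) (X : metricType R)
    (l : R) (C : set X) (T : X -> X) (x y : X) :
  CAT0 X -> 0 < l < 1 -> firmly_nonexpansive l C T -> C x -> C y ->
  mdist (T x) (T y) <=
    (1 - l) ^+ 2 * mdist x y + l * (1 - l) * (mdist x (T y) + mdist (T x) y)
    + l ^+ 2 * mdist (T x) (T y).
Proof.
move=> hX l01 hT Cx Cy; have l01' : 0 <= l <= 1 by lra.
have l0 : 0 <= l by lra.
have l1 : 0 <= 1 - l by lra.
apply: le_trans (hT x y Cx Cy) _.
rewrite metric_sym.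
apply: le_trans (conv_comb_dist_le _ _ l x (T x) _ hX l01') _.
rewrite !(metric_sym (conv_comb l y _)).
have := ler_wpM2l l1 (conv_comb_dist_le _ _ l y (T y) x hX l01').
have := ler_wpM2l l0 (conv_comb_dist_le _ _ l y (T y) (T x) hX l01').
lra.
Qed.

(** * Consequences of boundedness *)

Lemma mdist_le_diameter (R : realType) (X : metricType R) (C : set X) (b : R)
    (x y : X) :
  bounded_subset C -> diameter C <= b -> C x -> C y -> mdist x y <= b.
Proof.
move=> hC hb Cx Cy; apply: le_trans hb; apply: ub_le_sup => //.
by exists x => //; exists y.
Qed.

(** Convexity makes the increments nondecreasing, so [D] grows at least linearly with slope [D 1]; a
    positive slope would contradict the bound. *)
Lemma bounded_convex_seq_le0 (R : realType) (D : nat -> R) (b : R) :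
  D 0%N = 0 -> (forall k, 2 * D k.+1 <= D k + D k.+2) ->
  (forall k, D k <= b) -> D 1%N <= 0.
Proof.
move=> D0 conv bnd.
have step k : D 1%N <= D k.+1 - D k.
  by elim: k => [|k IH]; [rewrite D0 subr0|have := conv k; lra].
have lin k : k%:R * D 1%N <= D k.
  elim: k => [|k IH]; first by rewrite mul0r D0.
  by rewrite -natr1; have := step k; lra.
rewrite leNgt; apply/negP => D1.
have := truncnS_gt (b / D 1%N); rewrite ltr_pdivrMr// ltNge => /negP; apply.
exact: le_trans (lin _) (bnd _).
Qed.

(** * Asymptotics of the orbit of a point *)

Section orbit.
Context (R : realType) (X : metricType R) (l b : R) (C : set X) (T : X -> X)
  (x : X).
Hypotheses (hX : CAT0 X) (l01 : 0 < l < 1) (hTC : set_fun C C T)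
  (hT : firmly_nonexpansive l C T) (Cx : C x)
  (hb : forall y z, C y -> C z -> mdist y z <= b).

Let o n := iter n T x.
Let Co n : C (o n). Proof. by elim: n => //= n; apply: hTC. Qed.
Let a n := mdist (o n) (o n.+1).

Lemma orbit_gap_nonincreasing k m n : (m <= n)%N ->
  mdist (o n) (o (n + k)) <= mdist (o m) (o (m + k)).
Proof.
elim: n => [|n IH]; first by rewrite leqn0 => /eqP ->.
rewrite leq_eqVlt => /predU1P[<- //|/IH]; apply: le_trans.
rewrite addSn.
exact: (firmly_nonexpansive_nonexpansive _ _ l C T _ _ hX l01 hT (Co n)
  (Co _)).
Qed.

Lemma orbit_gap_small e : 0 < e -> exists n, a n < e.
Proof.
move=> e0; pose u k n := mdist (o n) (o (n + k)).
have cu k : cvgn (u k).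
  apply: nonincreasing_is_cvgn; first exact: orbit_gap_nonincreasing.
  by exists 0 => _ [n _ <-]; exact: mdist_ge0.
pose D k := limn (u k).
have cS k : (u k n.+1) @[n --> \oo] --> D k.
  by rewrite cvg_shiftS; exact: cu.
have D1 : D 1%N <= 0.
  apply: (@bounded_convex_seq_le0 _ _ b) => [|k|k].
  - rewrite /D; have -> : u 0%N = cst 0; last exact: lim_cst.
    by apply/funext => n; rewrite /u addn0 mdistxx.
  - have key n : u k.+1 n.+1 <= (1 - l) ^+ 2 * u k.+1 n
        + l * (1 - l) * (u k.+2 n + u k n.+1) + l ^+ 2 * u k.+1 n.+1.
      have := firmly_nonexpansive_cross _ _ l C T _ _ hX l01 hT (Co n)
        (Co (n + k.+1)).
      by rewrite /u !addSn !addnS.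
    have : D k.+1 <= (1 - l) ^+ 2 * D k.+1
        + l * (1 - l) * (D k.+2 + D k) + l ^+ 2 * D k.+1.
      apply: (ler_cvg_to (cS k.+1)); last by apply: nearW => n; exact: key.
      apply: cvgD; [apply: cvgD|]; apply: cvgMr; try apply: cvgD;
        by [exact: cu|exact: cS].
    have c0 : 0 < l * (1 - l).
      by case/andP: l01 => ? ?; rewrite mulr_gt0 ?subr_gt0.
    (* As 1 - (1 - l)^2 - l^2 = 2 l (1 - l), dividing the limit inequality by l (1 - l) gives
       convexity of [D]. *)
    by move=> h; rewrite -subr_ge0 -(pmulr_rge0 _ c0); lra.
  - apply: limr_le; first exact: cu.
    by apply: nearW => n; apply: hb; exact: Co.
have : D 1%N < e by exact: le_lt_trans D1 e0.
have [//|h De] := pselect (exists n, a n < e).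
suff : e <= D 1%N by rewrite leNgt De.
apply: limr_ge; first exact: cu.
apply: nearW => n; rewrite leNgt; apply/negP => une; apply: h; exists n.
by move: une; rewrite /u addn1.
Qed.

(* The point p plays the role of a fixed point, up to an error d. *)
Lemma orbit_step_le p d n : C p -> mdist p (T p) <= d ->
  l * (1 - l) * a n ^+ 2 <=
    (1 - l) * (mdist p (o n) ^+ 2 - mdist p (o n.+1) ^+ 2)
    + (4 * b * d + 4 * d ^+ 2).
Proof.
move=> Cp pd; have l01' : 0 <= l <= 1 by move: l01; lra.
set z := conv_comb l (o n) (o n.+1).
have zb : mdist p z <= b.
  apply: le_trans (conv_comb_dist_le _ _ l _ _ _ hX l01') _.
  have := hb _ _ Cp (Co n); have := hb _ _ Cp (Co n.+1).
  by case/andP: l01'; nra.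
(* The error d(p, Tp) <= d enters twice: in passing from [p] to [T p], and in replacing
   [conv_comb l p (T p)] by [p]. *)
have pz : mdist p (o n.+1) <= mdist p z + 2 * d.
  apply: le_trans (metric_triangle _ (T p) _) _.
  have := hT _ _ Cp (Co n); rewrite -/(o n.+1) -/z => h.
  have := metric_triangle (conv_comb l p (T p)) p z.
  have [+ _] := conv_combP p (T p) hX l01'.
  rewrite (metric_sym _ p) => ->.
  have := mdist_ge0 p (T p); case/andP: l01'; nra.
have := CAT0_conv_comb _ _ l (o n) (o n.+1) p hX l01'; rewrite -/z -/(a n).
have := mdist_ge0 p z; have d0 := le_trans (mdist_ge0 _ _) pd.
have := mdist_ge0 p (o n.+1).
move: zb pz; move: (mdist p z) (mdist p (o n)) (mdist p (o n.+1)) (a n).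
move=> r s t q rb tr t0 r0.
(* Since r <= b, expanding the square yields the error 4 b d + 4 d^2. *)
have : t ^+ 2 <= (r + 2 * d) ^+ 2.
  by rewrite lerXn2r ?nnegrE// addr_ge0// mulr_ge0.
nra.
Qed.

Lemma orbit_gap_sq_le n : n.+1%:R * (l * (1 - l) * a n ^+ 2) <= b ^+ 2.
Proof.
have l1 : 0 <= 1 - l by move: l01; lra.
have b0 : 0 <= b by rewrite -(mdistxx x); exact: hb.
(* The step estimates telescope over the first [m] indices. Replacing a m by a n requires m <= n;
   the second disjunct lets the induction run past that range. *)
have aux p d m : C p -> mdist p (T p) <= d ->
    m%:R * (l * (1 - l) * a n ^+ 2) <=
    (1 - l) * (mdist p (o 0) ^+ 2 - mdist p (o m) ^+ 2)
    + m%:R * (4 * b * d + 4 * d ^+ 2) \/ (n.+1 < m)%N.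
  move=> Cp pd; elim: m => [|m [IH|mn]]; [left; lra| |by right; rewrite ltnW].
  have [mn|mn] := ltnP n m; [by right|left].
  have : l * (1 - l) * a n ^+ 2 <= l * (1 - l) * a m ^+ 2.
    rewrite ler_wpM2l ?mulr_ge0//; first by move: l01; lra.
    rewrite lerXn2r ?nnegrE ?mdist_ge0//.
    by have := orbit_gap_nonincreasing 1 _ _ mn; rewrite !addn1.
  have := orbit_step_le p d m Cp pd; rewrite -natr1; lra.
apply/ler_addgt0Pr => e e0.
(* With d <= 1 the total error is at most (n + 1)(4 b + 4) d, hence at most [e]. *)
pose d := Num.min 1 (e / (n.+1%:R * (4 * b + 4))).
have k0 : 0 < n.+1%:R * (4 * b + 4) by rewrite mulr_gt0//; lra.
have d0 : 0 < d by rewrite lt_min ltr01 divr_gt0.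
have d1 : d <= 1 by rewrite ge_min lexx.
have de : d * (n.+1%:R * (4 * b + 4)) <= e.
  by rewrite -ler_pdivlMr// ge_min lexx orbT.
have [N /ltW Nd] := orbit_gap_small _ d0.
have [|] := aux (o N) d n.+1 (Co N) Nd; last by rewrite ltnn.
have s0b : mdist (o N) (o 0) ^+ 2 <= b ^+ 2.
  by rewrite lerXn2r ?nnegrE ?mdist_ge0// hb.
have : n.+1%:R * (4 * b * d + 4 * d ^+ 2) <= e.
  apply: le_trans de; rewrite [leRHS]mulrCA ler_wpM2l//; nra.
have := sqr_ge0 (mdist (o N) (o n.+1)).
have := sqr_ge0 (mdist (o N) (o 0)).
move: s0b; move: (_ ^+ 2) (_ ^+ 2) (b ^+ 2) => ? ? ?.
case/andP: l01; nra.
Qed.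

End orbit.

(** * The explicit rate *)

Theorem corollary7p4 (R : realType) (b lambda : R)
    (hb : 0 < b) (hlambda : 0 < lambda < 1)
    (X : metricType R) (hX : CAT0 X)
    (C : set X) (hC : bounded_subset C) (hdC : diameter C <= b)
    (T : X -> X) (hTC : set_fun C C T)
    (hT : firmly_nonexpansive lambda C T)
    (x : X) (hx : C x) :
  forall eps : R, 0 < eps ->
  forall n : nat, (Psi eps lambda b <= n)%N ->
    mdist (iter n T x) (iter n.+1 T x) <= eps.
Proof.
move=> eps eps0 n.
have hCb y z : C y -> C z -> mdist y z <= b by exact: mdist_le_diameter.
have Co m : C (iter m T x) by elim: m => //= m; apply: hTC.
rewrite /Psi; case: ifPn => [_|]; last first.
  by rewrite -leNgt => beps _; have := hCb _ _ (Co n) (Co n.+1); lra.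
have ll0 : 0 < lambda * (1 - lambda).
  by case/andP: hlambda => ? ?; rewrite mulr_gt0 ?subr_gt0.
(* An integer part is at most [n] exactly when the number is below n + 1, which matches the n + 1
   summed terms. *)
rewrite truncn_le_nat mul1r ltr_pdivrMr ?exprn_gt0// ltr_pdivrMr// => hn.
have := orbit_gap_sq_le _ _ _ _ _ _ x hX hlambda hTC hT hx hCb n => hq.
rewrite -(ler_pXn2r (n := 2)) ?nnegrE ?mdist_ge0 ?(ltW eps0)//.
move: (mdist _ _ ^+ 2) hq => q hq; rewrite leNgt; apply/negP => epsq.
(* If eps^2 < q, then (n + 1) lambda (1 - lambda) q exceeds 8 (b + 1)^2, contradicting its upper
   bound b^2. *)
have : n.+1%:R * (lambda * (1 - lambda) * eps ^+ 2) <
       n.+1%:R * (lambda * (1 - lambda) * q) by rewrite !ltr_pM2l.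
nra.
Qed.
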